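(* Let $R$ be a commutative artinian ring, $\Lambda$ an Artin $R$-algebra, $d\geq 1$ an integer, $\mathcal{M}$ a $d$-cluster-tilting subcategory of $\operatorname{mod}\Lambda$, and $X,N\in\mathcal{M}$. Then for each $\operatorname{End}_\Lambda(X)$-submodule $H\subseteq\operatorname{Hom}_\Lambda(X,N)$ there exists a morphism $g\colon M\to N$ in $\mathcal{M}$ which is right $X$-determined in $\mathcal{M}$ and such that $\operatorname{Im}\operatorname{Hom}_\Lambda(X,g)=H$.
   Context: $\operatorname{mod}\Lambda$ is the category of finite length right $\Lambda$-modules. All subcategories of $\operatorname{mod}\Lambda$ are full and closed under (finite) direct sums and direct summands. A functorially finite (i.e. contravariantly and covariantly finite) subcategory $\mathcal{M}$ of $\operatorname{mod}\Lambda$ is $d$-cluster-tilting if $$\mathcal{M}=\{X\mid \operatorname{Ext}^k_\Lambda(X,\mathcal{M})=0\ \forall k\in\{1,\dots,d-1\}\}=\{Y\mid \operatorname{Ext}^k_\Lambda(\mathcal{M},Y)=0\ \forall k\in\{1,\dots,d-1\}\}$$ with $X,Y$ ranging over $\operatorname{mod}\Lambda$. $\operatorname{Hom}_\Lambda(X,N)$ is an $\operatorname{End}_\Lambda(X)$-module via precomposition. Let $\mathcal{X}$ be a subcategory of $\operatorname{mod}\Lambda$ and $X\in\mathcal{X}$. A morphism $g\colon M\to N$ in $\mathcal{X}$ is right $X$-determined in $\mathcal{X}$ if every morphism $h\colon V\to N$ in $\mathcal{X}$ with $\operatorname{Im}\operatorname{Hom}_\Lambda(X,h)\subseteq\operatorname{Im}\operatorname{Hom}_\Lambda(X,g)$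 factors through $g$. *)

(* Defs.v *)
From HB Require Import structures.
From mathcomp Require Import all_boot all_algebra.
From mathcomp Require Import boolp classical_sets.

Set Implicit Arguments.
Unset Strict Implicit.
Unset Printing Implicit Defensive.

Import GRing.Theory.
Local Open Scope classical_set_scope.
Local Open Scope ring_scope.

(* Everything below is about left modules over S. Right modules over a ring L *)
(* are obtained by taking S := L^c, the converse ring: v . l is l *: v.       *)
Section Modules.
Variable S : pzRingType.
Implicit Types X Y V W C : lmodType S.

Definition submodule V (U : set V) : Prop := submod_closed (mem U).

Definition artinian_module V : Prop :=
  forall U : nat -> set V,
    (forall n, submodule (U n)) -> (forall n, U n.+1 `<=` U n) ->
    exists m, forall n, (m <= n)%N -> U n = U m.

(* Existence of a composition series 0 = U 0 < U 1 < ... < U n = V; the third *)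
(* condition says that U i.+1 / U i is a simple module.                       *)
Definition finite_length V : Prop :=
  exists (n : nat) (U : nat -> set V),
    [/\ U 0%N = [set 0], U n = [set: V],
        forall i, (i <= n)%N -> submodule (U i)
      & forall i, (i < n)%N ->
          U i `<` U i.+1 /\
          forall W : set V, submodule W -> U i `<=` W -> W `<=` U i.+1 ->
            W = U i \/ W = U i.+1].

Definition projective (P : lmodType S) : Prop :=
  forall V W (p : {linear V -> W}) (f : {linear P -> W}),
    range p = [set: W] -> exists g : {linear P -> V}, p \o g =1 f.

Record projective_resolution X := ProjectiveResolution {
  res_obj : nat -> lmodType S;
  res_diff : forall n, {linear res_obj n.+1 -> res_obj n};
  res_aug : {linear res_obj 0%N -> X};
  res_projective : forall n, projective (res_obj n);
  res_aug_surj : range res_aug = [set: X];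
  res_exact0 : range (res_diff 0%N) = res_aug @^-1` [set 0];
  res_exact : forall n, range (res_diff n.+1) = res_diff n @^-1` [set 0] }.

(* Vanishing of the k-th cohomology of the complex Hom(P, Y).                 *)
Definition Hom_cohomology_vanishes X (P : projective_resolution X) Y (k : nat)
  : Prop :=
  match k with
  | 0 => forall f : {linear res_obj P 0%N -> Y},
           f \o res_diff P 0%N =1 \0 -> f =1 \0
  | j.+1 => forall f : {linear res_obj P j.+1 -> Y},
           f \o res_diff P j.+1 =1 \0 ->
           exists g : {linear res_obj P j -> Y}, g \o res_diff P j =1 f
  end.

(* Ext^k(X, Y) = 0. Projective resolutions always exist and the cohomology    *)
(* does not depend on the resolution, so "for every" here means the same as   *)
(* "for some".                                                                *)
Definition Ext_vanishes (k : nat) X Y : Prop :=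
  forall P : projective_resolution X, Hom_cohomology_vanishes P Y k.

Implicit Type M : lmodType S -> Prop.

(* A full subcategory of the category of finite length modules is given by    *)
(* its objects. Y is a direct summand of X if and only if it is a retract;    *)
(* hence subcategories are in particular closed under isomorphism. The zero   *)
(* module is the empty direct sum.                                            *)
Definition subcategory M : Prop :=
  [/\ forall V, M V -> finite_length V,
      forall V, [set: V] = [set 0] -> M V,
      forall V W, M V -> M W -> M (V * W)%type
    & forall X Y (i : {linear Y -> X}) (p : {linear X -> Y}),
        p \o i =1 id -> M X -> M Y].

Definition contravariantly_finite M : Prop :=
  forall C, finite_length C ->
    exists A : lmodType S, M A /\ exists a : {linear A -> C},
      forall V, M V -> forall h : {linear V -> C},
        exists q : {linear V -> A}, a \o q =1 h.

Definition covariantly_finite M : Prop :=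
  forall C, finite_length C ->
    exists A : lmodType S, M A /\ exists a : {linear C -> A},
      forall V, M V -> forall h : {linear C -> V},
        exists q : {linear A -> V}, q \o a =1 h.

Definition functorially_finite M : Prop :=
  contravariantly_finite M /\ covariantly_finite M.

Definition cluster_tilting (d : nat) M : Prop :=
  [/\ subcategory M, functorially_finite M,
      forall X, finite_length X ->
        (M X <-> forall k, (1 <= k <= d.-1)%N ->
                   forall Y, M Y -> Ext_vanishes k X Y)
    & forall Y, finite_length Y ->
        (M Y <-> forall k, (1 <= k <= d.-1)%N ->
                   forall X, M X -> Ext_vanishes k X Y)].

Definition Hom_post X V W (g : {linear V -> W}) (s : {linear X -> V})
  : {linear X -> W} := g \o s.

Definition Im_Hom X V W (g : {linear V -> W}) : set {linear X -> W} :=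
  range (@Hom_post X V W g).

(* Submodules of Hom(X, W) for the action of End(X) by precomposition.        *)
(* Closure under opposites is included, because - f = f \o (- id).            *)
Definition End_submodule X W (H : set {linear X -> W}) : Prop :=
  [/\ H \0,
      forall f g : {linear X -> W}, H f -> H g -> H (f \+ g)
    & forall (f : {linear X -> W}) (e : {linear X -> X}), H f -> H (f \o e)].

Definition right_determined M X (A B : lmodType S) (g : {linear A -> B})
  : Prop :=
  forall V, M V -> forall h : {linear V -> B},
    Im_Hom (X := X) h `<=` Im_Hom (X := X) g ->
    exists q : {linear V -> A}, g \o q =1 h.

End Modules.

Arguments right_determined {S} M X {A B} g.
Arguments Im_Hom {S} X {V W} g.

(* R is artinian as a module over itself, phi makes L an R-algebra, and L is  *)
(* a finitely generated R-module. The structure of R-algebra is given by phi  *)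
(* and not by algType R, which would exclude the zero algebra.                *)
Definition artin_algebra (R : comPzRingType) (L : pzRingType)
    (phi : {rmorphism R -> L}) : Prop :=
  [/\ artinian_module R^o,
      forall (r : R) (x : L), phi r * x = x * phi r
    & exists (n : nat) (b : 'I_n -> L), forall x : L,
        exists c : 'I_n -> R, x = \sum_(i < n) phi (c i) * b i].

(* Main.v *)
Require Import Defs.
From HB Require Import structures.
From mathcomp Require Import all_boot all_algebra.
From mathcomp Require Import boolp classical_sets.

(* Let F V be the set of h : V -> N such that h \o phi lies in H for every    *)
(* phi : X -> V. It suffices to find g : C -> N with C of finite length and   *)
(* g in F C through which every h in F V factors: composing g with a right    *)
(* M-approximation A -> C gives the required morphism.                        *)
(*                                                                            *)
(* Choose generators x_1, ..., x_a of X with a finite matrix k of relations,  *)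
(* so that Hom(X, V) is the kernel of k : V^a -> V^b, and an R-linear map     *)
(* chi from N^a to an injective R-module E of finite length whose kernel is   *)
(* { (h x_i)_i | h in H }. Then h is in F V iff chi \o h^a vanishes on the    *)
(* kernel of k, and by injectivity of E this means that chi \o h^a factors    *)
(* through k : V^a -> V^b by some R-linear omega : V^b -> E. Such an omega is *)
(* the same thing as a linear map from V to Hom_R(L^b, E), so C can be taken  *)
(* to be a pullback of N and Hom_R(L^b, E).                                   *)
(*                                                                            *)
(* E is an essential extension of maximal length of a quotient of N^a; its    *)
(* length is bounded because R has finite length (Hopkins' theorem).          *)

(** [H] lies in F X because it is stable under End(X). Let every member of F factor through g : C ->
    N in F C, and let a : A -> C be a right approximation. Then every h in F V with V in [M] factors
    through g \o a, which puts [H] inside Im Hom(X, g \o a); the reverse inclusion is g in F C.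
    Determination follows, since Im Hom(X, h) inside [H] means h in F V.

    [determined_cover] constructs g. The equivalence between membership in F and factorization
    through k is split into [pullback_factor], which uses the injectivity of E, and
    [pullback_vanish]. [injective_hull] provides E and chi, [finite_length_presentation] the matrix
    k, and [submodule_restrictions] shows that the prescribed kernel of chi is an R-submodule.
    Finite length is handled through [ranked]: [artinian_ranked] is Hopkins' theorem, and
    [pullback_ranked] bounds C. *)

Set Implicit Arguments.
Unset Strict Implicit.
Unset Printing Implicit Defensive.

Import GRing.Theory.
Local Open Scope classical_set_scope.
Local Open Scope ring_scope.

(** * Rank functions and submodules *)

(* [c] is strictly increasing on [S], with values at most [n]. For S the set of *)
(* submodules of V this says that V has finite length, in a form that is        *)
(* inherited along monotone maps and needs no Jordan-Hoelder theorem.           *)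
Definition ranked (T : Type) (S : set (set T)) (n : nat) : Prop :=
  exists c : set T -> nat,
    (forall U, S U -> (c U <= n)%N) /\
    (forall U W, S U -> S W -> U `<=` W -> (c W <= c U)%N -> U = W).

Lemma ranked_setT_unit : ranked [set: set unit] 1.
Proof.
exists (fun U => `[< U tt >] : nat); split=> [U _|U W _ _ UW le].
  by case: asboolP.
apply/seteqP; split=> // -[] Wt; apply/asboolP; move: le.
by rewrite (asboolT Wt); case: asboolP.
Qed.

(** The ranks of the [Phi j U] add up to a rank of U: each summand is monotone, so if the sum does
    not grow from U to a larger W, no summand grows, and all [Phi j U] and [Phi j W] agree. *)
Lemma ranked_via (T : Type) (T' : nat -> Type) (S : set (set T))
    (S' : forall j, set (set (T' j))) (k n : nat) (Phi : forall j, set T -> set (T' j)) :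
  (forall j, (j < k)%N -> ranked (S' j) n) ->
  (forall j U, (j < k)%N -> S U -> S' j (Phi j U)) ->
  (forall j U W, (j < k)%N -> U `<=` W -> Phi j U `<=` Phi j W) ->
  (forall U W, S U -> S W -> U `<=` W ->
     (forall j, (j < k)%N -> Phi j U = Phi j W) -> W `<=` U) ->
  ranked S (k * n).
Proof.
move=> rk PhiS Phi_mono Phi_inj.
have /choice[c Hc] : forall j, exists c : set T -> nat, (j < k)%N ->
    (forall U, S U -> (c U <= n)%N) /\
    (forall U W, S U -> S W -> U `<=` W -> (c W <= c U)%N -> Phi j U = Phi j W) /\
    (forall U W, Phi j U = Phi j W -> c U = c W).
  move=> j; case: (ltnP j k) => [jk|_]; last by exists (fun=> 0%N).
  have [c [b m]] := rk j jk; exists (c \o Phi j) => _; split=> [U SU|].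
    exact/b/PhiS.
  split=> [U W SU SW UW|U W /= -> //].
  by apply: m; [exact: PhiS|exact: PhiS|exact: Phi_mono].
have c_mono j U W : (j < k)%N -> S U -> S W -> U `<=` W -> (c j U <= c j W)%N.
  move=> jk SU SW UW; have [_ [m e]] := Hc j jk.
  case: leqP => // lt_c.
  by move: (lt_c); rewrite (e _ _ (m U W SU SW UW (ltnW lt_c))) ltnn.
exists (fun U => \sum_(j < k) c j U); split=> [U SU|U W SU SW UW le].
  rewrite -[X in (X * _)%N](card_ord k) -sum_nat_const.
  by apply: leq_sum => j _; apply: (proj1 (Hc j (ltn_ord j))).
apply/seteqP; split => //; apply: Phi_inj => // j jk.
apply: (proj1 (proj2 (Hc j jk))) => //.
rewrite leqNgt; apply/negP => lt; move: le; rewrite leqNgt => /negP; apply.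
rewrite (bigD1 (Ordinal jk)) //= [ltnRHS](bigD1 (Ordinal jk)) //= -addSn.
by apply: leq_add => //; apply: leq_sum => i _; apply: c_mono.
Qed.

Lemma ranked_sub (T : Type) (S S' : set (set T)) n :
  S `<=` S' -> ranked S' n -> ranked S n.
Proof.
by move=> SS' [c [b m]]; exists c; split=> [U|U W] /SS' SU; [exact: b|move=> /SS'; exact: m].
Qed.

Lemma ranked_leq (T : Type) (S : set (set T)) n n' :
  (n <= n')%N -> ranked S n -> ranked S n'.
Proof.
by move=> le [c [b m]]; exists c; split=> // U /b /leq_trans; apply.
Qed.

Lemma ranked_chain (T : Type) (S : set (set T)) n k (U : nat -> set T) :
  ranked S n -> (forall i, (i <= k)%N -> S (U i)) ->
  (forall i, (i < k)%N -> U i `<` U i.+1) -> (k <= n)%N.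
Proof.
move=> [c [b m]] SU Ult.
have H i : (i <= k)%N -> (i <= c (U i))%N.
  elim: i => // i IH ik; apply: (leq_ltn_trans (IH (ltnW ik))).
  rewrite ltnNge; apply/negP => /m e.
  have := Ult i ik; rewrite e; [by case=> _; apply| by apply/SU/ltnW|exact: SU|].
  by case: (Ult i ik).
exact: leq_trans (H k (leqnn _)) (b _ (SU _ (leqnn _))).
Qed.

Lemma ex_max_nat (P : nat -> Prop) n :
  (exists k, P k) -> (forall k, P k -> (k <= n)%N) ->
  exists k, P k /\ forall k', P k' -> (k' <= k)%N.
Proof.
move=> [k0 Pk0] bP.
have ex : exists k, `[< P k >] by exists k0; apply/asboolP.
have b : forall k, `[< P k >] -> (k <= n)%N by move=> k /asboolP; exact: bP.
case: (ex_maxnP ex b) => k /asboolP Pk kmax; exists k; split=> // k' Pk'.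
by apply: kmax; apply/asboolP.
Qed.

Lemma ranked_max (T : Type) (S : set (set T)) n :
  ranked S n -> S !=set0 ->
  exists U, S U /\ forall W, S W -> U `<=` W -> W = U.
Proof.
move=> [c [b m]] [U0 SU0].
have [k [[U [SU <-]] kmax]] : exists k, (exists U, S U /\ c U = k) /\
    forall k', (exists U, S U /\ c U = k') -> (k' <= k)%N.
  apply: (@ex_max_nat _ n); first by exists (c U0), U0.
  by move=> k [U [SU <-]]; exact: b.
exists U; split=> // W SW UW; apply/esym/m => //.
by apply: kmax; exists W.
Qed.

Section Submodules.
Variables (S : pzRingType) (V : lmodType S).
Implicit Types U W A B : set V.

Lemma submoduleP U :
  submodule U <-> U 0 /\ forall a u v, U u -> U v -> U (a *: u + v).
Proof.
split=> -[U0 UL]; split; first by move: U0; rewrite inE.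
- by move=> a u v Uu Uv; have := UL a u v; rewrite !inE; apply.
- by rewrite inE.
- by move=> a u v; rewrite !inE; exact: UL.
Qed.

Section Closure.
Variables (U : set V) (hU : submodule U).

Lemma submodule0 : U 0. Proof. by case/submoduleP: hU. Qed.

Lemma submoduleL a u v : U u -> U v -> U (a *: u + v).
Proof. by case/submoduleP: hU => _; apply. Qed.

Lemma submoduleD u v : U u -> U v -> U (u + v).
Proof. by rewrite -{2}[u]scale1r; exact: submoduleL. Qed.

Lemma submoduleZ a u : U u -> U (a *: u).
Proof. by move=> Uu; rewrite -[_ *: _]addr0; apply: submoduleL => //; exact: submodule0. Qed.

Lemma submoduleN u : U u -> U (- u).
Proof. by rewrite -scaleN1r; exact: submoduleZ. Qed.

Lemma submoduleB u v : U u -> U v -> U (u - v).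
Proof. by move=> Uu Uv; apply: submoduleD => //; exact: submoduleN. Qed.

End Closure.

Definition add_set A B : set V := [set x | exists a b, [/\ A a, B b & x = a + b]].

Lemma submodule_set1 : submodule [set 0 : V].
Proof. by apply/submoduleP; split=> // a u v -> ->; rewrite scaler0 add0r. Qed.

Lemma submoduleT : submodule [set: V].
Proof. by apply/submoduleP. Qed.

Lemma submoduleI A B : submodule A -> submodule B -> submodule (A `&` B).
Proof.
move=> hA hB; apply/submoduleP; split; first by split; exact: submodule0.
by move=> a u v [Au Bu] [Av Bv]; split; apply: submoduleL.
Qed.

Lemma submodule_add A B : submodule A -> submodule B -> submodule (add_set A B).
Proof.
move=> hA hB; apply/submoduleP; split.
  by exists 0, 0; split; [exact: submodule0|exact: submodule0|rewrite addr0].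
move=> c _ _ [a [b [Aa Bb ->]]] [a' [b' [Aa' Bb' ->]]].
exists (c *: a + a'), (c *: b + b'); split; [exact: submoduleL|exact: submoduleL|].
by rewrite scalerDr addrACA.
Qed.

Lemma add_setl A B : submodule B -> A `<=` add_set A B.
Proof. by move=> hB a Aa; exists a, 0; split=> //; [exact: submodule0|rewrite addr0]. Qed.

Lemma add_setr A B : submodule A -> B `<=` add_set A B.
Proof. by move=> hA b Bb; exists 0, b; split=> //; [exact: submodule0|rewrite add0r]. Qed.

Definition line (v : V) : set V := range (fun a : S => a *: v).

Lemma submodule_line v : submodule (line v).
Proof.
apply/submoduleP; split; first by exists 0 => //; rewrite scale0r.
by move=> a _ _ [b _ <-] [c _ <-]; exists (a * b + c) => //; rewrite scalerDl scalerA.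
Qed.

Lemma line_id v : line v v.
Proof. by exists 1; rewrite ?scale1r. Qed.

Lemma submodule_bigcap (P : set (set V)) :
  (forall W, P W -> submodule W) -> submodule [set x | forall W, P W -> W x].
Proof.
move=> hP; apply/submoduleP; split=> [W PW|a u v Hu Hv W PW].
  exact: submodule0 (hP W PW).
by apply: (submoduleL (hP W PW)); [exact: Hu|exact: Hv].
Qed.

(* With Z a singleton this gives maximal submodules, with Z the nonzero elements *)
(* of a submodule it gives essential quotients, and with Z the pairs (0, e),    *)
(* e <> 0, it gives maximal graphs of partial linear maps.                      *)
Lemma zorn_avoid A (Z : set V) : submodule A -> A `&` Z = set0 ->
  exists W, [/\ submodule W, A `<=` W, W `&` Z = set0 &
    forall z, ~ W z -> exists w r, W w /\ Z (w + r *: z)].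
Proof.
move=> hA AZ.
pose P : set (set V) := [set W | W = set0 \/
  [/\ submodule W, A `<=` W & W `&` Z = set0]].
have [F FP Ftot|W [PW Wmax]] := @Zorn_bigcup V P.
  have [[W0 [FW0 [x W0x]]]|Fe] := pselect (exists W, F W /\ W !=set0); last first.
    left; apply/seteqP; split=> // x [W FW Wx]; apply: Fe.
    by exists W; split=> //; exists x.
  have FS W y : F W -> W y -> [/\ submodule W, A `<=` W & W `&` Z = set0].
    by move=> FW Wy; case: (FP W FW) => // We; rewrite We in Wy.
  have [hW0 AW0 _] := FS _ _ FW0 W0x.
  right; split.
  - apply/submoduleP; split; first by exists W0 => //; exact: submodule0.
    move=> a u v [U FU Uu] [U' FU' U'v].
    have [hU _ _] := FS _ _ FU Uu; have [hU' _ _] := FS _ _ FU' U'v.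
    case: (Ftot U U' FU FU') => sub.
      by exists U' => //; apply: submoduleL => //; exact: sub.
    by exists U => //; apply: submoduleL => //; exact: sub.
  - by move=> a Aa; exists W0 => //; exact: AW0.
  - apply/seteqP; split=> // y [[U FU Uy] Zy].
    by have [_ _ UZ] := FS _ _ FU Uy; rewrite -UZ.
have PA : P A by right; split.
have W_ne : W !=set0.
  apply/set0P/eqP => We; apply: (Wmax A) => //; rewrite We; split=> // /(_ 0).
  by move/(_ (submodule0 hA)).
case: PW => [We|[hW AW WZ]]; first by rewrite We in W_ne; case: W_ne.
exists W; split=> // z Wz.
have hWz := submodule_add hW (submodule_line z).
have WWz : W `<=` add_set W (line z) by apply/add_setl/submodule_line.
have : ~ P (add_set W (line z)).
  apply: Wmax; split=> // /(_ z); apply: contra_not Wz; apply.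
  by apply: add_setr => //; exact: line_id.
move=> nP; apply: contrapT => nZ; apply: nP; right; split=> //.
  exact: subset_trans AW WWz.
apply/seteqP; split=> // y [[w [_ [Ww [r _ <-] ->]]] Zy]; apply: nZ.
by exists w, r.
Qed.

Definition between A B : set (set V) :=
  [set U | [/\ submodule U, A `<=` U & U `<=` B]].

(** By the modular law, nested submodules with the same intersection with B and the same sum with B
    coincide. *)
Lemma ranked_trans A B C n m : submodule B -> submodule C ->
  A `<=` B -> B `<=` C -> ranked (between A B) n -> ranked (between B C) m ->
  ranked (between A C) (2 * maxn n m).
Proof.
move=> hB hC AB BC rn rm.
apply: (@ranked_via _ (fun=> _) _
  (fun j => if j is 0%N then between A B else between B C)
  _ _ (fun j U => if j is 0%N then U `&` B else add_set U B)).
- case=> [_|j _]; [apply: ranked_leq rn|apply: ranked_leq rm].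
    exact: leq_maxl.
  exact: leq_maxr.
- case=> [|j] U _ [hU AU UC]; split.
  + exact: submoduleI.
  + by move=> a Aa; split; [exact: AU|exact: AB].
  + by move=> a [].
  + exact: submodule_add.
  + exact: add_setr.
  + move=> _ [u [b [Uu Bb ->]]].
    by apply: submoduleD => //; [exact: UC|exact: BC].
- case=> [|j] U W _ UW x; first by move=> [/UW ? ?].
  by move=> [u [b [/UW ? ? ->]]]; exists u, b.
- move=> U W [hU AU UC] [hW AW WC] UW H w Ww.
  have := H 1%N isT; have := H 0%N isT => /= eI eA.
  have : add_set W B w by apply: add_setl.
  rewrite -eA => -[u [b [Uu Bb def_w]]].
  have : (W `&` B) b.
    by split=> //; rewrite -[b](addKr u) -def_w addrC; apply: submoduleB => //; exact: UW.
  rewrite -eI => -[Ub _]; rewrite def_w; exact: submoduleD.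
Qed.

End Submodules.

(** * Finite length *)

Section FiniteLength.
Variable S : pzRingType.
Implicit Types V W : lmodType S.

(** The rank of U counts the factors of a composition series W in which U has a nonzero image. If U
    inside U' have the same such factors, simplicity allows an element of U' to be corrected by one
    of U into the next lower term. *)
Lemma finite_length_ranked V :
  finite_length V -> exists n, ranked (@submodule S V) n.
Proof.
move=> [n [W [W0 Wn hW W_simple]]]; exists (n * 1)%N.
apply: (@ranked_via _ (fun=> unit) _ (fun=> [set: set unit]) _ _
  (fun j U _ => exists x, [/\ U x, W j.+1 x & ~ W j x])) => //.
- by move=> j _; exact: ranked_setT_unit.
- by move=> j U U' _ UU' t [x [/UU' Ux Wx nWx]]; exists x.
move=> U U' hU hU' UU' H x U'x.
suff Hj j y : (j <= n)%N -> U' y -> W j y -> U y.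
  by apply: (Hj n) => //; rewrite Wn.
elim: j y => [|j IH] y jn U'y Wy.
  by rewrite W0 in Wy; rewrite Wy; exact: submodule0.
have [Wjy|nWjy] := pselect (W j y); first exact: IH (ltnW jn) _ _.
have /seteqP[_ /(_ tt)[|u [Uu Wu nWu]]] := H j jn; first by exists y.
have [[Wsub _] Wmax] := W_simple j jn.
have hWj := hW j (ltnW jn); have hWj1 := hW j.+1 jn.
have WlW : add_set (W j) (line u) `<=` W j.+1.
  move=> _ [w [_ [Ww [r _ <-] ->]]].
  by apply: submoduleD => //; [exact: Wsub|exact: submoduleZ].
have [e|e] := Wmax _ (submodule_add hWj (submodule_line u))
    (add_setl (submodule_line u)) WlW.
  by case: nWu; rewrite -e; apply: add_setr => //; exact: line_id.
move: Wy; rewrite -e => -[w [_ [Ww [r _ <-] def_y]]].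
have Uru : U (r *: u) by exact: submoduleZ.
rewrite def_y; apply: submoduleD => //; apply: IH (ltnW jn) _ Ww.
by rewrite -[w](addrK (r *: u)) -def_y; apply: submoduleB => //; exact: UU'.
Qed.

(** The rank bounds strict chains from 0 to V. A longest one is a composition series, since a
    submodule strictly between two terms could be inserted. *)
Lemma ranked_finite_length V n : ranked (@submodule S V) n -> finite_length V.
Proof.
move=> rV.
pose chain k (U : nat -> set V) := [/\ U 0%N = [set 0], U k = setT,
  forall i, (i <= k)%N -> submodule (U i)
  & forall i, (i < k)%N -> U i `<` U i.+1].
have [k [[U [U0 Uk hU Ult]] kmax]] : exists k, (exists U, chain k U) /\
    forall k', (exists U, chain k' U) -> (k' <= k)%N.
  apply: (@ex_max_nat _ n); last first.
    by move=> k [U [_ _ hU Ult]]; exact: ranked_chain rV hU Ult.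
  have [e|ne] := pselect ([set 0] = [set: V]).
    exists 0%N, (fun=> setT); split=> // i _; exact: submoduleT.
  exists 1%N, (fun i => if i is 0%N then [set 0] else setT); split=> //.
    by case=> [|i] _; [exact: submodule_set1|exact: submoduleT].
  by case=> // _; split=> [x _ //|sub]; apply: ne; apply/seteqP.
exists k, U; split=> // i ik; split; first exact: Ult.
move=> W hW UW WU; apply: contrapT => /not_orP[ne1 ne2].
suff : (k.+1 <= k)%N by rewrite ltnn.
apply: kmax; exists (fun j => if (j <= i)%N then U j else
  if (j == i.+1)%N then W else U j.-1); split=> //=.
- by rewrite leqNgt (leq_trans ik) //= eqSS gtn_eqF.
- move=> j jk; case: ifP => ji; first by apply: hU; rewrite (leq_trans ji) // ltnW.
  by case: ifP => // _; apply: hU; rewrite -ltnS prednK //; case: (j) ji.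
move=> j jk; case: (ltngtP j i) => [ji|ij|->].
- by apply: Ult; exact: ltn_trans ik.
- rewrite eqSS (gtn_eqF ij) /=; case: eqP => [->|/eqP ji].
    by split=> // sub; apply: ne2; apply/seteqP; split.
  have j0 : (0 < j)%N by case: (j) ij.
  by rewrite -{2}(prednK j0); apply: Ult; rewrite prednK.
- rewrite eqxx; split=> // sub; apply: ne1; apply/seteqP; split=> //.
Qed.

(* U is determined by the sets f_j (U `&` ker f_0 `&` ... `&` ker f_(j-1)).      *)
Lemma ranked_sep V (W : nat -> lmodType S) k n (f : forall j, {linear V -> W j}) :
  (forall j, (j < k)%N -> ranked (@submodule S (W j)) n) ->
  (forall v, (forall j, (j < k)%N -> f j v = 0) -> v = 0) ->
  ranked (@submodule S V) (k * n).
Proof.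
move=> rW f_inj.
apply: (@ranked_via _ W _ (fun j => @submodule S (W j)) _ _ (fun j U =>
  [set w | exists u, [/\ U u, forall i, (i < j)%N -> f i u = 0 & f j u = w]])) => //.
- move=> j U _ hU; apply/submoduleP; split.
    by exists 0; split=> [|i _|]; rewrite ?raddf0 //; exact: submodule0.
  move=> a _ _ [u [Uu u0 <-]] [v [Uv v0 <-]]; exists (a *: u + v); split.
  + exact: submoduleL.
  + by move=> i ij; rewrite linearP u0 // v0 // scaler0 addr0.
  + by rewrite linearP.
- by move=> j U U' _ UU' w [u [/UU' Uu u0 fu]]; exists u.
move=> U U' hU hU' UU' H x U'x.
suff Hm m y j : (j + m = k)%N -> U' y -> (forall i, (i < j)%N -> f i y = 0) -> U y.
  by apply: (Hm k x 0%N).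
elim: m y j => [|m IH] y j jm U'y y0.
  rewrite (f_inj y); first exact: submodule0.
  by move=> i ik; apply: y0; rewrite -[j]addn0 jm.
have jk : (j < k)%N by rewrite -jm addnS ltnS leq_addr.
have /seteqP[_ /(_ (f j y))[|u [Uu u0 fuy]]] := H j jk; first by exists y.
rewrite -[y](subrK u); apply: submoduleD => //; apply: (IH _ j.+1).
- by rewrite -jm addnS.
- by apply: submoduleB => //; exact: UU'.
move=> i; rewrite ltnS leq_eqVlt linearB => /predU1P[->|ij].
  by rewrite fuy subrr.
by rewrite y0 // u0 // subr0.
Qed.

(* U is determined by the sets of w with                                        *)
(* f_j w in U + im f_0 + ... + im f_(j-1).                                      *)
Lemma ranked_gen V W k n (f : nat -> {linear W -> V}) :
  ranked (@submodule S W) n ->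
  (forall v, exists w : nat -> W, v = \sum_(j < k) f j (w j)) ->
  ranked (@submodule S V) (k * n).
Proof.
move=> rW f_surj.
apply: (@ranked_via _ (fun=> W) _ (fun=> @submodule S W) _ _ (fun j U =>
  [set w | exists w' : nat -> W, U (\sum_(i < j) f i (w' i) + f j w)])) => //.
- move=> j U _ hU; apply/submoduleP; split.
    exists (fun=> 0); rewrite big1 ?raddf0 ?addr0; first exact: submodule0.
    by move=> i _; rewrite raddf0.
  move=> a w1 w2 [v1 Uv1] [v2 Uv2]; exists (fun i => a *: v1 i + v2 i).
  rewrite linearP (eq_bigr (fun i : 'I_j => a *: f i (v1 i) + f i (v2 i))).
    rewrite big_split /= -scaler_sumr addrACA -scalerDr; exact: submoduleL.
  by move=> i _; rewrite linearP.
- by move=> j U U' _ UU' w [w' /UU' Uw]; exists w'.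
move=> U U' hU hU' UU' H x U'x.
suff Hj j y (w : nat -> W) : (j <= k)%N -> U' y -> y = \sum_(i < j) f i (w i) -> U y.
  have [w def_x] := f_surj x; exact: (Hj k x w).
elim: j y w => [|j IH] y w jk U'y def_y.
  by rewrite def_y big_ord0; exact: submodule0.
rewrite big_ord_recr /= in def_y.
have /seteqP[_ /(_ (w j))[|w' Uw']] := H j jk; first by exists w; rewrite -def_y.
rewrite -[y](subrK (\sum_(i < j) f i (w' i) + f j (w j))).
apply: submoduleD => //; apply: (IH _ (fun i => w i - w' i)) (ltnW jk) _ _.
  by apply: submoduleB => //; exact: UU'.
rewrite def_y opprD addrACA subrr addr0 -sumrB.
by apply: eq_bigr => i _; rewrite linearB.
Qed.

(** A maximal finitely generated submodule of U contains each v in U, since adjoining v as a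
    generator does not enlarge it. *)
Lemma ranked_fingen V n (U : set V) : ranked (@submodule S V) n -> submodule U ->
  exists (a : nat) (x : 'I_a -> V),
    forall v, U v <-> exists c : 'I_a -> S, v = \sum_i c i *: x i.
Proof.
move=> rV hU.
pose gen a (x : 'I_a -> V) := [set v | exists c : 'I_a -> S, v = \sum_i c i *: x i].
have h_gen a (x : 'I_a -> V) : submodule (gen a x).
  apply/submoduleP; split.
    by exists (fun=> 0); rewrite big1 // => i _; rewrite scale0r.
  move=> r _ _ [c ->] [c' ->]; exists (fun i => r * c i + c' i).
  rewrite scaler_sumr -big_split; apply: eq_bigr => i _ /=.
  by rewrite scalerDl scalerA.
pose P : set (set V) := [set W | W `<=` U /\ exists a x, W = gen a x].
have rP : ranked P n by apply: ranked_sub rV => _ [_ [a [x ->]]].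
have [|W [[WU [a [x def_W]]] Wmax]] := ranked_max rP.
  exists (gen 0%N (fun=> 0)); split; last by exists 0%N, (fun=> 0).
  by move=> _ [c ->]; rewrite big_ord0; exact: submodule0.
subst W; exists a, x => v; split=> [Uv|].
  pose x' (i : 'I_a.+1) := if unlift ord0 i is Some j then x j else v.
  have e c : \sum_i c i *: x' i = c ord0 *: v + \sum_i c (lift ord0 i) *: x i.
    rewrite big_ord_recl {1}/x' unlift_none; congr (_ + _).
    by apply: eq_bigr => i _; rewrite /x' liftK.
  have gen_v : gen a.+1 x' v.
    exists (fun i => if unlift ord0 i is Some j then 0 else 1).
    rewrite e unlift_none scale1r big1 ?addr0 // => i _.
    by rewrite liftK scale0r.
  suff e' : gen a.+1 x' = gen a x by move: gen_v; rewrite e'.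
  apply: Wmax; first (split; last by exists a.+1, x').
    move=> _ [c ->]; rewrite e; apply: submoduleD => //.
      exact: submoduleZ.
    by apply: WU; exists (fun i => c (lift ord0 i)).
  move=> _ [c ->].
  exists (fun i => if unlift ord0 i is Some j then c j else 0).
  rewrite e unlift_none scale0r add0r; apply: eq_bigr => i _.
  by rewrite liftK.
by move=> H; apply: WU.
Qed.

End FiniteLength.

(** * Hopkins' theorem *)

(** Otherwise repeated choice of a strictly smaller member yields a descending chain that never
    stabilizes. *)
Lemma artinian_min (S : pzRingType) (V : lmodType S) (P : set (set V)) :
  artinian_module V -> (forall W, P W -> submodule W) -> P !=set0 ->
  exists W, P W /\ forall W', P W' -> W' `<=` W -> W `<=` W'.
Proof.
move=> artV hP [W0 PW0]; apply: contrapT => no_min.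
have /choice[next Hnext] : forall W, exists W', P W ->
    [/\ P W', W' `<=` W & ~ W `<=` W'].
  move=> W; have [PW|nPW] := pselect (P W); last by exists W.
  apply: contrapT => no_next; apply: no_min; exists W; split=> // W' PW' W'W.
  apply: contrapT => nWW'; apply: no_next; exists W' => _; split=> //.
pose U n := iter n next W0.
have PU n : P (U n) by elim: n => //= n /Hnext[].
have Usub n : U n.+1 `<=` U n by case: (Hnext _ (PU n)).
have [m /(_ m.+1 (leqnSn m)) e] := artV U (fun n => hP _ (PU n)) Usub.
by have [_ _] := Hnext _ (PU m); rewrite -[next _]/(U m.+1) e; apply.
Qed.

Section Hopkins.
Variable R : comPzRingType.
Implicit Types (I J A B W : set R^o).

Let mul_in A (a x : R) : submodule A -> A x -> A (a * x).
Proof. by move=> hA Ax; exact: (@submoduleZ R R^o A hA a x). Qed.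

(* Every R/I-module that is a subquotient of R has finite length.               *)
Definition finite_layers I : Prop :=
  submodule I /\ forall A B, submodule A -> submodule B -> A `<=` B ->
    (forall i b : R, I i -> B b -> A (i * b)) -> exists n, ranked (between A B) n.

Definition ideal_prod I J : set R^o :=
  [set x | forall W, submodule W /\ (forall i j : R, I i -> J j -> W (i * j)) -> W x].

Lemma submodule_ideal_prod I J : submodule (ideal_prod I J).
Proof. by apply: submodule_bigcap => W []. Qed.

Lemma ideal_prod_mul I J (i j : R) : I i -> J j -> ideal_prod I J (i * j).
Proof. by move=> Ii Jj W [_]; apply. Qed.

Lemma ideal_prod_subr I J : submodule J -> ideal_prod I J `<=` J.
Proof. by move=> hJ x; apply; split=> // i j _; exact: mul_in. Qed.

Lemma ideal_prod_subl I J : submodule I -> ideal_prod I J `<=` I.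
Proof.
by move=> hI x; apply; split=> // i j Ii _; rewrite mulrC; exact: mul_in.
Qed.

(** Between A and B lies M = A + JB, written as an intersection of submodules: I kills M / A because
    IJ kills B / A, and J kills B / M. *)
Lemma finite_layers_prod I J :
  finite_layers I -> finite_layers J -> finite_layers (ideal_prod I J).
Proof.
move=> [hI fI] [hJ fJ]; split; first exact: submodule_ideal_prod.
move=> A B hA hB AB IJB.
pose M : set R^o := [set x | forall W, submodule W /\
  (A `<=` W /\ forall j b : R, J j -> B b -> W (j * b)) -> W x].
have hM : submodule M by apply: submodule_bigcap => W [].
have AM : A `<=` M by move=> a Aa W [_ [AW _]]; exact: AW.
have MB : M `<=` B.
  by move=> x; apply; split=> //; split=> // j b _; exact: mul_in.
have [n rn] : exists n, ranked (between A M) n.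
  apply: fI => // i x Ii /(_ [set z : R^o | A (i * z : R)]); apply; split.
    apply/submoduleP; split; first by rewrite /= mulr0; exact: (submodule0 hA).
    move=> a u v Au Av; rewrite /= mulrDr -[a *: u]/(a * u) mulrCA.
    by apply: (submoduleD hA) => //; exact: mul_in.
  split=> [a Aa|j b Jj Bb]; first exact: mul_in.
  by rewrite /= mulrA; apply: IJB => //; exact: ideal_prod_mul.
have [m rm] : exists m, ranked (between M B) m.
  by apply: fJ => // j b Jj Bb W [_ [_]]; apply.
by exists (2 * maxn n m)%N; exact: ranked_trans rn rm.
Qed.

Hypothesis artR : artinian_module R^o.

(** Take W minimal with B / W of finite length. If x lies in W but not in A, a submodule W1
    containing A and maximal without x makes W / (W [&] W1) simple, against minimality. *)
Lemma finite_layers_max I : submodule I ->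
  (forall z : R, ~ I z -> exists i r : R, I i /\ i + r * z = 1) -> finite_layers I.
Proof.
move=> hI maxI; split=> // A B hA hB AB IBA.
pose P : set (set R^o) := [set W | between A B W /\ exists n, ranked (between W B) n].
have [||W [[[hW AW WB] [n rW]] Wmin]] := @artinian_min _ _ P artR.
- by move=> W [[]].
- exists B; split; first by split.
  exists 0%N, (fun=> 0%N); split=> // U U' [_ BU UB] [_ BU' U'B] _ _.
  by apply/seteqP; split; [exact: subset_trans BU'|exact: subset_trans BU].
have [WA|] := pselect (W `<=` A).
  have -> : A = W by apply/seteqP.
  by exists n.
move=> /existsNP[x /not_implyP[Wx nAx]].
have [|W1 [hW1 AW1 W1x W1max]] := @zorn_avoid _ _ A [set x] hA.
  by apply/seteqP; split=> // y [Ay /= e]; apply: nAx; rewrite -e.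
have nW1x : ~ W1 x by move=> W1x'; rewrite -[False]/(set0 x) -W1x.
have hW' := submoduleI hW hW1.
(* A U not contained in W1 contains x, and x generates W modulo the intersection because a scalar
   outside I is invertible modulo I. *)
have simple_layer U : between (W `&` W1) W U -> U `<=` W `&` W1 \/ W `<=` U.
  move=> [hU W'U UW].
  have [UW1|] := pselect (U `<=` W1); first by left=> u Uu; split; [exact: UW|exact: UW1].
  move=> /existsNP[u /not_implyP[Uu /W1max[w1 [r [W1w1 /= def_x]]]]]; right.
  have Ux : U x.
    rewrite -def_x; apply: submoduleD => //; last exact: submoduleZ.
    apply: W'U; split=> //; rewrite -[w1](addrK (r *: u)) def_x.
    by apply: (submoduleB hW Wx); apply: UW; exact: (submoduleZ hU).
  move=> z Wz; have [W1z|/W1max[w [s [W1w /= def_x']]]] := pselect (W1 z).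
    exact: W'U.
  have nIs : ~ I s.
    move=> Is; apply: nW1x; rewrite -def_x'; apply: submoduleD => //; apply: AW1.
    by apply: IBA => //; exact: WB.
  have [i [t [Ii def1]]] := maxI s nIs.
  have Uw : U w.
    apply: W'U; split=> //; rewrite -[w](addrK (s *: z)) def_x'.
    by apply: submoduleB => //; exact: submoduleZ.
  have -> : z = i * z + (t * x - t * w) :> R.
    by rewrite -def_x' mulrDr addrAC subrr add0r mulrA -mulrDl def1 mul1r.
  apply: (submoduleD hU); first apply: W'U.
    by split; [apply: AW|apply: AW1]; apply: IBA => //; exact: WB.
  by apply: (submoduleB hU); exact: mul_in.
have rW' : ranked (between (W `&` W1) W) 1.
  exists (fun U => `[< W `<=` U >] : nat); split=> [U _|U U' bU bU' UU' le].
    by case: asboolP.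
  apply/seteqP; split=> //.
  case: (simple_layer _ bU') => [U'W'|WU'].
    by case: bU => _ W'U _; exact: subset_trans W'U.
  move: le; rewrite (asboolT WU'); case: asboolP => // WU _.
  by case: bU' => _ _ U'W; exact: subset_trans WU.
have /(_ x Wx)[_ /nW1x//] : W `<=` W `&` W1.
apply: Wmin; last by move=> ? [].
split; last first.
  by exists (2 * maxn 1 n)%N; apply: ranked_trans rW' rW => // ? [].
split=> //; first by move=> a Aa; split; [exact: AW|exact: AW1].
by move=> y [/WB].
Qed.

(* Let J be minimal among the ideals with finite layers. Then J J = J and J is  *)
(* contained in every maximal ideal. If J <> 0, a minimal K with K J <> 0 has   *)
(* the form k0 J with k0 in K, so k0 = k0 y for some y in J; but 1 - y is a     *)
(* unit. Hence J = 0.                                                           *)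
Lemma artinian_ranked : exists n, ranked (@submodule R R^o) n.
Proof.
have [||J [fJ Jmin]] := @artinian_min _ _ finite_layers artR.
- by move=> I [].
- exists setT; split; first exact: submoduleT.
  move=> A B hA hB AB TBA; exists 0%N, (fun=> 0%N); split=> // U U' [_ AU UB] [_ AU' U'B] _ _.
  have BA : B `<=` A by move=> b Bb; rewrite -[b](@mul1r R); exact: TBA.
  by apply/seteqP; split=> u; [move/UB/BA/AU'|move/U'B/BA/AU].
have hJ : submodule J by case: fJ.
have JJ : J `<=` ideal_prod J J.
  by apply: Jmin; [exact: finite_layers_prod|exact: ideal_prod_subr].
have J_min I : finite_layers I -> J `<=` I.
  move=> fI; have hI := proj1 fI; apply: subset_trans (ideal_prod_subl hI).
  by apply: Jmin (ideal_prod_subr hJ); exact: finite_layers_prod fI fJ.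
suff J0 : J `<=` [set 0].
  (* If J = 0, then R over 0 is a layer killed by J, hence of finite length. *)
  case: fJ => _ /(_ [set 0] setT); case=> //.
  - exact: submodule_set1.
  - exact: submoduleT.
  - by move=> i b /J0 -> _; rewrite mul0r.
  move=> n rn; exists n; apply: ranked_sub rn => U hU; split=> //.
  by move=> _ ->; exact: submodule0.
apply: contrapT => Jn0.
pose P : set (set R^o) := [set K : set R^o | submodule K /\
  exists k j : R, [/\ K k, J j & k * j <> 0]].
have [||K [[hK [k0 [j0 [Kk0 Jj0 k0j0]]]] Kmin]] := @artinian_min _ _ P artR.
- by move=> K [].
- exists J; split=> //; apply: contrapT => none; apply: Jn0 => x /JJ; apply; split.
    exact: submodule_set1.
  by move=> i j Ji Jj; apply: contrapT => ne; apply: none; exists i, j.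
pose k0J : set R^o := [set x | exists j : R, J j /\ x = k0 * j].
have [||y [Jy def_k0]] := Kmin k0J _ _ k0 Kk0.
- split.
    apply/submoduleP; split; first by exists 0; split; [exact: (submodule0 hJ)|rewrite mulr0].
    move=> a _ _ [u [Ju ->]] [v [Jv ->]]; exists (a * u + v); split.
      exact: (submoduleL hJ).
    by rewrite mulrDr mulrCA.
  (* If k0 J J vanished, k0 would annihilate J J, which contains j0. *)
  apply: contrapT => none; apply: k0j0.
  have : [set x : R^o | k0 * x = 0] j0.
    apply: (JJ _ Jj0); split.
      apply/submoduleP; split; first by rewrite /= mulr0.
      move=> a u v /= u0 v0; rewrite mulrDr v0 addr0 -[a *: u]/(a * u).
      by rewrite mulrCA u0 mulr0.
    move=> i j Ji Jj /=; apply: contrapT => ne; apply: none.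
    by exists (k0 * i), j; split=> //; [exists i|rewrite -mulrA].
  by [].
- by move=> _ [j [Jj ->]]; rewrite mulrC; exact: mul_in.
(* Otherwise 1 - y lies in a maximal ideal; by [J_min] that ideal also contains y, hence 1. *)
have [s def1] : exists s : R, s * (1 - y) = 1.
  apply: contrapT => nunit.
  have [|m [hm ym m1 mmax]] := @zorn_avoid _ _ (line (1 - y : R^o)) [set 1] (submodule_line _).
    by apply/seteqP; split=> // z [[s _ <-] /= e]; apply: nunit; exists s.
  have my : m y by apply: J_min Jy; exact: finite_layers_max.
  have : (m `&` [set 1]) (1 : R).
    split=> //; rewrite -[1](subrK y); apply: (submoduleD hm) => //.
    by apply: ym; exact: line_id.
  by rewrite m1.
have k0y : k0 * (1 - y) = 0 by rewrite mulrBr mulr1 -def_k0 subrr.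
by apply: k0j0; rewrite -[k0]mulr1 -def1 [s * _]mulrC mulrA k0y !mul0r.
Qed.

End Hopkins.

(** * Submodules, quotients, restriction of scalars and duals as modules *)

Definition mk_linear (S : pzRingType) (V W : lmodType S) (f : V -> W)
    (hf : linear f) : {linear V -> W} :=
  HB.pack f (GRing.isLinear.Build S V W *:%R f hf).

Lemma linear_ext (S : pzRingType) (V W : lmodType S) (f g : {linear V -> W}) :
  f =1 g -> f = g.
Proof.
case: f g => [f [[Df] [Zf]]] [g [[Dg] [Zg]]] /= /funext e.
case: g / e Dg Zg => Dg Zg.
by rewrite (Prop_irrelevance Df Dg) (Prop_irrelevance Zf Zg).
Qed.

Section SubModuleType.
Variables (S : pzRingType) (V : lmodType S) (U : set V) (hU : submodule U).

(** The closure proof is an argument of the type so that the module structure can be inferred from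
    the type. *)
Definition submodule_type of submodule U : Type := {v : V | v \in U}.
Local Notation T := (submodule_type hU).

HB.instance Definition _ := SubType.copy T {v : V | v \in U}.
HB.instance Definition _ := Choice.copy T {v : V | v \in U}.
HB.instance Definition _ :=
  GRing.SubChoice_isSubLmodule.Build S V (fun v => v \in U) T
    (GRing.submod_closed_semi hU).

Lemma submodule_module : exists (C : lmodType S) (i : {linear C -> V}), [/\
  injective i, forall c, U (i c) &
  forall (W : lmodType S) (f : {linear W -> V}), (forall w, U (f w)) ->
    exists f' : {linear W -> C}, forall w, i (f' w) = f w].
Proof.
exists T, (mk_linear (linearP (val : T -> V))); split; first exact: val_inj.
  by move=> x; have := valP x; rewrite inE.
move=> W f Uf; pose f' w : T := exist _ (f w) (mem_set (Uf w)).
have f'_linear : linear f' by move=> a v w; apply: val_inj; rewrite /= linearP.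
by exists (mk_linear f'_linear).
Qed.

End SubModuleType.

Section QuotientModuleType.
Variables (S : pzRingType) (V : lmodType S) (U : set V) (hU : submodule U).

Definition coset_repr (v : V) : V := xget 0 [set w | U (v - w)].

Lemma coset_reprP v : U (v - coset_repr v).
Proof.
apply: (@xgetPex _ 0 [set w | U (v - w)]).
by exists v; rewrite /= subrr; exact: submodule0.
Qed.

(** Congruent elements have the same set of candidates, and [xget] depends on that set alone. *)
Lemma coset_repr_eq v w : U (v - w) -> coset_repr v = coset_repr w.
Proof.
move=> Uvw; congr xget; apply/seteqP; split=> x /= Ux.
  by rewrite -(subrKA v) -opprB; apply: submoduleD => //; exact: submoduleN.
by rewrite -(subrKA w); exact: submoduleD.
Qed.

(* The quotient is the type of the chosen representatives of the cosets.        *)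
Definition quotient_type of submodule U : Type := {v : V | coset_repr v == v}.
Local Notation Q := (quotient_type hU).

HB.instance Definition _ := SubType.copy Q {v : V | coset_repr v == v}.
HB.instance Definition _ := Choice.copy Q {v : V | coset_repr v == v}.

Let mk (v : V) : Q.
Proof.
exists (coset_repr v); apply/eqP/coset_repr_eq.
by rewrite -opprB; apply: submoduleN => //; exact: coset_reprP.
Defined.

Let mkP v w : mk v = mk w <-> U (v - w).
Proof.
split=> [/(congr1 val) /= e|Uvw]; last by apply/val_inj/coset_repr_eq.
rewrite -(subrKA (coset_repr v)) {2}e -[_ - w]opprB.
by apply: submoduleB => //; exact: coset_reprP.
Qed.

Let mkK (q : Q) : mk (val q) = q.
Proof. by apply/val_inj/eqP; exact: (valP q). Qed.

Let add (q r : Q) := mk (val q + val r).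
Let opp (q : Q) := mk (- val q).
Let scale a (q : Q) := mk (a *: val q).

Let mkD v w : add (mk v) (mk w) = mk (v + w).
Proof.
by apply/mkP; rewrite opprD addrACA; apply: submoduleD => //;
  rewrite -opprB; apply: submoduleN => //; exact: coset_reprP.
Qed.

Let mkN v : opp (mk v) = mk (- v).
Proof. by apply/mkP; rewrite opprK addrC; exact: coset_reprP. Qed.

Let mkZ a v : scale a (mk v) = mk (a *: v).
Proof.
apply/mkP; rewrite -scalerBr; apply: submoduleZ => //.
by rewrite -opprB; apply: submoduleN => //; exact: coset_reprP.
Qed.

Let addA : associative add.
Proof. by move=> q r s; rewrite -[q]mkK -[r]mkK -[s]mkK !mkD addrA. Qed.
Let addC : commutative add.
Proof. by move=> q r; rewrite -[q]mkK -[r]mkK !mkD addrC. Qed.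
Let add0 : left_id (mk 0) add.
Proof. by move=> q; rewrite -[q]mkK !mkD add0r. Qed.
Let addN : left_inverse (mk 0) opp add.
Proof. by move=> q; rewrite -[q]mkK mkN !mkD addNr. Qed.

HB.instance Definition _ := GRing.isZmodule.Build Q addA addC add0 addN.

Let scaleA a b q : scale a (scale b q) = scale (a * b) q.
Proof. by rewrite -[q]mkK !mkZ scalerA. Qed.
Let scale1 : left_id 1 scale.
Proof. by move=> q; rewrite -[q]mkK mkZ scale1r. Qed.
Let scaleDr : right_distributive scale +%R.
Proof.
by move=> a q r; rewrite -[q]mkK -[r]mkK -[_ + _]/(add _ _) mkD !mkZ scalerDr -mkD.
Qed.
Let scaleDl q : {morph scale^~ q : a b / a + b}.
Proof. by move=> a b; rewrite -[q]mkK !mkZ scalerDl -mkD. Qed.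

HB.instance Definition _ := GRing.Zmodule_isLmodule.Build S Q
  scaleA scale1 scaleDr scaleDl.

Let mk_is_linear : linear mk.
Proof. by move=> a v w; rewrite -mkD -mkZ. Qed.

Lemma quotient_module : exists (Q' : lmodType S) (q : {linear V -> Q'}),
  (forall x, exists v, q v = x) /\ forall v, q v = 0 <-> U v.
Proof.
exists Q, (mk_linear mk_is_linear); split=> [x|v]; first by exists (val x); exact: mkK.
by have := mkP v 0; rewrite subr0.
Qed.

End QuotientModuleType.

Section RestrictionOfScalars.
Variables (R S : pzRingType) (psi : {rmorphism R -> S}) (V : lmodType S).

Definition restr of {rmorphism R -> S} : Type := V.
Local Notation T := (restr psi).

HB.instance Definition _ := GRing.Zmodule.copy T V.

Let scale (r : R) (v : V) := psi r *: v.

Let scaleA a b v : scale a (scale b v) = scale (a * b) v.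
Proof. by rewrite /scale scalerA rmorphM. Qed.
Let scale1 : left_id 1 scale.
Proof. by move=> v; rewrite /scale rmorph1 scale1r. Qed.
Let scaleDr : right_distributive scale +%R.
Proof. by move=> a v w; rewrite /scale scalerDr. Qed.
Let scaleDl v : {morph scale^~ v : a b / a + b}.
Proof. by move=> a b; rewrite /scale rmorphD scalerDl. Qed.

HB.instance Definition _ := GRing.Zmodule_isLmodule.Build R T
  scaleA scale1 scaleDr scaleDl.

End RestrictionOfScalars.

Section LinearFunctions.
Variables (R S : pzRingType) (psi : {rmorphism R -> S}) (b : nat) (E : lmodType R).

Definition row_space : Type := restr {ffun 'I_b -> S^o} psi.
HB.instance Definition _ := GRing.Lmodule.on row_space.

(* Hom_R(S^b, E), with S acting by (s f) y = f (y s).                           *)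
Definition dual_type : Type := {linear row_space -> E}.
Implicit Types f g h : dual_type.

HB.instance Definition _ := gen_eqMixin dual_type.
HB.instance Definition _ := gen_choiceMixin dual_type.

Let app f (y : row_space) : E := (f : {linear row_space -> E}) y.

Let add_linear f g : linear (fun y => app f y + app g y).
Proof. by move=> a x y; rewrite /app !linearP scalerDr addrACA. Qed.
Let opp_linear f : linear (fun y => - app f y).
Proof. by move=> a x y; rewrite /app linearP opprD scalerN. Qed.
Let zero_linear : linear (fun _ : row_space => 0 : E).
Proof. by move=> a x y; rewrite scaler0 addr0. Qed.

Let add f g : dual_type := mk_linear (add_linear f g).
Let opp f : dual_type := mk_linear (opp_linear f).
Let zero : dual_type := mk_linear zero_linear.

Let addA : associative add.
Proof. by move=> f g h; apply/linear_ext => y; exact: addrA. Qed.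
Let addC : commutative add.
Proof. by move=> f g; apply/linear_ext => y; exact: addrC. Qed.
Let add0 : left_id zero add.
Proof. by move=> f; apply/linear_ext => y; exact: add0r. Qed.
Let addN : left_inverse zero opp add.
Proof. by move=> f; apply/linear_ext => y; exact: addNr. Qed.

HB.instance Definition _ := GRing.isZmodule.Build dual_type addA addC add0 addN.

Definition mulr_row (y : row_space) (s : S) : row_space :=
  [ffun j => (y : {ffun 'I_b -> S^o}) j * s].

Let scale_linear (s : S) f : linear (fun y => app f (mulr_row y s)).
Proof.
move=> a x y; rewrite /app -linearP; congr (app f _).
by apply/ffunP => j; rewrite !ffunE mulrDl -mulrA.
Qed.

Let scale s f : dual_type := mk_linear (scale_linear s f).

Let scaleA s t f : scale s (scale t f) = scale (s * t) f.
Proof.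
apply/linear_ext => y; congr (app f _).
by apply/ffunP => j; rewrite !ffunE mulrA.
Qed.
Let scale1 : left_id 1 scale.
Proof.
move=> f; apply/linear_ext => y; congr (app f _).
by apply/ffunP => j; rewrite !ffunE mulr1.
Qed.
Let scaleDr : right_distributive scale +%R.
Proof. by move=> s f g; exact/linear_ext. Qed.
Let scaleDl f : {morph scale^~ f : s t / s + t}.
Proof.
move=> s t; apply/linear_ext => y.
rewrite -[RHS]/(app f _ + app f _) /app -raddfD; congr (app f _).
by apply/ffunP => j; rewrite !ffunE mulrDr.
Qed.

HB.instance Definition _ := GRing.Zmodule_isLmodule.Build S dual_type
  scaleA scale1 scaleDr scaleDl.

Definition dual_app (y : row_space) f : E := app f y.

Lemma dual_app_sum y (I : finType) (f : I -> dual_type) :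
  dual_app y (\sum_i f i) = \sum_i dual_app y (f i).
Proof. exact: (big_morph (dual_app y) (id1 := 0) (op1 := +%R)). Qed.

Hypothesis psi_central : forall r s, psi r * s = s * psi r.

(** Centrality turns f (y psi(r)) into f (psi(r) y) = r f(y). *)
Let dual_app_linear y : linear (fun f : restr dual_type psi => dual_app y f).
Proof.
move=> r f g; rewrite -[LHS]/(app f _ + app g y) /app /dual_app -linearZZ.
congr (app f _ + _); apply/ffunP => j; rewrite !ffunE; exact/esym/psi_central.
Qed.

Definition dual_eval y : {linear restr dual_type psi -> E} :=
  mk_linear (dual_app_linear y).

End LinearFunctions.

(** * Injective hulls *)

Lemma submodule_image (S : pzRingType) (V W : lmodType S) (f : {linear V -> W})
  (U : set V) : submodule U -> submodule (f @` U).
Proof.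
move=> hU; apply/submoduleP; split.
  by exists 0; rewrite ?raddf0 //; exact: submodule0.
move=> a _ _ [u Uu <-] [v Uv <-]; exists (a *: u + v); rewrite ?linearP //.
exact: submoduleL.
Qed.

Section InjectiveHull.
Variables (R : comPzRingType) (Y : lmodType R) (H : set Y).
Hypothesis hH : submodule H.

(** Equivalently, chi embeds Y / H into E as an essential submodule. *)
Definition essential_extension (E : lmodType R) (chi : {linear Y -> E}) : Prop :=
  (forall y, chi y = 0 <-> H y) /\
  forall e, e <> 0 -> exists (r : R) y, r *: e = chi y /\ r *: e <> 0.

(* Let 0 = I_0 < ... < I_k = R be a composition series with I_(j+1) = I_j + R a_j. *)
(* If e in E is killed by I_j, then a_j e is zero or generates a simple module, *)
(* so it lies in the image of chi. Hence U is determined by the k submodules    *)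
(* chi^-1 (a_j {u in U | I_j u = 0}) of Y.                                      *)
Lemma essential_extension_ranked n m :
  ranked (@submodule R R^o) n -> ranked (@submodule R Y) m ->
  exists N, forall (E : lmodType R) (chi : {linear Y -> E}),
    essential_extension chi -> ranked (@submodule R E) N.
Proof.
move=> /ranked_finite_length[k [I [I0 Ik hI I_simple]]] rY.
have /choice[a Ha] : forall j, exists a : R, (j < k)%N -> I j.+1 a /\ ~ I j a.
  move=> j; case: (ltnP j k) => [/I_simple[[_ /existsNP[a /not_implyP Ha]] _]|_].
    by exists a.
  by exists 0.
have a_gen j (x : R) : (j < k)%N -> ~ I j x -> I j.+1 x ->
    forall z : R, I j.+1 z -> exists r w : R, I j w /\ z = w + r * x.
  move=> jk nIx Ix z Iz; have [[Isub _] Imax] := I_simple j jk.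
  have hIj := hI j (ltnW jk); have hIj1 := hI j.+1 jk.
  have hx : submodule (line (x : R^o)) by exact: submodule_line.
  have sub : add_set (I j) (line (x : R^o)) `<=` I j.+1.
    move=> _ [w [_ [Iw [r _ <-] ->]]].
    by apply: (submoduleD hIj1); [exact: Isub|exact: (submoduleZ hIj1)].
  have [e|e] := Imax _ (submodule_add hIj hx) (add_setl hx) sub.
    by case: nIx; rewrite -e; apply: add_setr => //; exact: line_id.
  by move: Iz; rewrite -e => -[w [_ [Iw [r _ <-] ->]]]; exists r, w.
exists (k * m)%N => E chi [chiP ess].
pose ann j (e : E) := forall i : R, I j i -> i *: e = 0.
apply: (@ranked_via _ (fun=> Y) _ (fun=> @submodule R Y) _ _ (fun j U =>
  [set y | exists u, [/\ U u, ann j u & a j *: u = chi y]])) => //.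
- move=> j U _ hU; apply/submoduleP; split.
    exists 0; rewrite scaler0 raddf0; split=> //; first exact: submodule0.
    by move=> i _; rewrite scaler0.
  move=> r y z [u [Uu Iu e]] [v [Uv Iv e']]; exists (r *: u + v); split.
  + exact: submoduleL.
  + by move=> i Ii; rewrite scalerDr scalerA mulrC -scalerA Iu // Iv // scaler0 addr0.
  + by rewrite linearP -e -e' scalerDr !scalerA mulrC.
- by move=> j U U' _ UU' y [u [/UU' Uu Iu e]]; exists u.
move=> U U' hU hU' UU' Heq x U'x.
suff Hm l y j : (j + l = k)%N -> U' y -> ann j y -> U y.
  by apply: (Hm k x 0%N) => // i; rewrite I0 => ->; rewrite scale0r.
elim: l y j => [|l IH] y j jl U'y Iy.
  rewrite addn0 in jl; rewrite -[y]scale1r Iy ?jl ?Ik //; exact: submodule0.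
have jk : (j < k)%N by rewrite -jl addnS ltnS leq_addr.
have [Ia nIa] := Ha j jk.
have [y' def_ay] : exists y', a j *: y = chi y'.
  have [->|nz] := pselect (a j *: y = 0); first by exists 0; rewrite raddf0.
  have [r [z [def_z nz']]] := ess _ nz.
  have nIra : ~ I j (r * a j).
    by move=> Ira; apply: nz'; rewrite scalerA Iy.
  have Ira : I j.+1 (r * a j) by exact: (submoduleZ (hI _ jk)).
  have [s [w [Iw def_a]]] := a_gen j _ jk nIra Ira _ Ia.
  exists (s *: z); rewrite linearZ -def_z [in LHS]def_a scalerDl (Iy _ Iw) add0r.
  by rewrite -!scalerA.
have /seteqP[_ /(_ y')[|u [Uu Iu e]]] := Heq j jk; first by exists y.
rewrite -[y](subrK u); apply: submoduleD => //; apply: (IH _ j.+1).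
- by rewrite -jl addnS.
- by apply: submoduleB => //; exact: UU'.
move=> i /(a_gen j _ jk nIa Ia)[r [w [Iw ->]]].
rewrite scalerDl -scalerA !scalerBr (Iy w) // (Iu w) // e def_ay.
by rewrite !subrr addr0.
Qed.

(** Q is (E x R) / K. As K meets E x 0 trivially, E embeds in Q; by maximality of K every nonzero
    element of Q has a nonzero multiple in E, so essentiality passes on. If E fills Q, the class of
    (0, 1) comes from some e0. *)
Lemma essential_quotient (E : lmodType R) (chi : {linear Y -> E})
    (K : set (E * R^o)%type) (hK : submodule K) :
  essential_extension chi ->
  K `&` [set z | z.1 <> 0 /\ z.2 = 0] = set0 ->
  (forall z, ~ K z -> exists w (r : R), K w /\
    ((w + r *: z).1 <> 0 /\ (w + r *: z).2 = 0)) ->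
  exists (Q : lmodType R) (j : {linear E -> Q}) (chi' : {linear Y -> Q}),
    [/\ essential_extension chi', forall e, j e = 0 -> e = 0 &
      (forall q, exists e, j e = q) -> exists e0 : E, K (- e0, 1)].
Proof.
move=> [chiP ess] KZ Kmax.
have [Q [q [q_surj q_ker]]] := quotient_module hK.
have inl_linear : linear (fun e : E => (e, 0) : (E * R^o)%type).
  by move=> a x y; congr pair; rewrite /= scaler0 addr0.
pose j : {linear E -> Q} := q \o mk_linear inl_linear.
have j_inj e : j e = 0 -> e = 0.
  move=> /q_ker Ke; apply: contrapT => ne0.
  have : (K `&` [set z | z.1 <> 0 /\ z.2 = 0]) (e, 0) by [].
  by rewrite KZ.
exists Q, j, (j \o chi); split=> //.
  split=> [y|x nx].
    by split=> [/j_inj/chiP //|/chiP/= e]; rewrite /= e; exact: (raddf0 j).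
  have [z def_x] := q_surj x.
  have [w [r [Kw [n1 e2]]]] : exists w (r : R), K w /\
    ((w + r *: z).1 <> 0 /\ (w + r *: z).2 = 0).
    by apply: Kmax => Kz; apply: nx; rewrite -def_x; exact/q_ker.
  have [s [y [def_y ny]]] := ess _ n1.
  have e : (s * r) *: x = j (s *: (w + r *: z).1).
    rewrite -scalerA [RHS]linearZZ; congr (s *: _).
    have q0 : q w = 0 by exact/q_ker.
    have <- : q (w + r *: z) = r *: x by rewrite linearD linearZZ def_x q0 add0r.
    by rewrite [in LHS](surjective_pairing (w + r *: z)) e2.
  exists (s * r), y; rewrite e def_y; split=> // /j_inj.
  by rewrite -def_y.
move=> /(_ (q (0, 1)))[e0 def_e0]; exists e0.
apply/q_ker.
have -> : (- e0, 1) = (0, 1) - (e0, 0) :> (E * R^o)%type.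
  by congr pair; rewrite /= ?sub0r ?subr0.
by rewrite linearB -def_e0 subrr.
Qed.

(* If the graph G of a maximal partial extension misses b in its domain, then   *)
(* the quotient of E * R by a maximal K that contains all (e, r) with           *)
(* (r b, - e) in G, and meets E * 0 trivially, is an essential extension. By    *)
(* the choice of E it equals E, which provides a value for b.                   *)
Lemma injective_hull n m :
  ranked (@submodule R R^o) n -> ranked (@submodule R Y) m ->
  exists (E : lmodType R) (chi : {linear Y -> E}), [/\
    exists N, ranked (@submodule R E) N,
    forall y, chi y = 0 <-> H y &
    forall (A B : lmodType R) (alpha : {linear A -> B}) (theta : {linear A -> E}),
      (forall a, alpha a = 0 -> theta a = 0) ->
      exists omega : {linear B -> E}, forall a, omega (alpha a) = theta a].
Proof.
move=> rR rY; have [N rE] := essential_extension_ranked rR rY.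
pose chain (E : lmodType R) k := exists U : nat -> set E,
  (forall i, (i <= k)%N -> submodule (U i)) /\
  (forall i, (i < k)%N -> U i `<` U i.+1).
pose P k := exists (E : lmodType R) (chi : {linear Y -> E}),
  essential_extension chi /\ chain E k.
have [k [[E [chi [ess [U [hU Ult]]]]] kmax]] :
    exists k, P k /\ forall k', P k' -> (k' <= k)%N.
  apply: (@ex_max_nat _ N).
    have [Q [q [q_surj q_ker]]] := quotient_module hH.
    exists 0%N, Q, q; split.
      split=> // e ne0; have [y def_e] := q_surj e.
      by exists 1, y; rewrite scale1r def_e.
    by exists (fun=> setT); split=> // i _; exact: submoduleT.
  move=> k [E [chi [/rE rE' [U [hU Ult]]]]]; exact: ranked_chain rE' hU Ult.
exists E, chi; split; [by exists N; exact: rE ess|by case: ess|].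
move=> A B alpha theta ker_sub.
pose Z : set (B * E)%type := [set z | z.1 = 0 /\ z.2 <> 0].
have g0_linear : linear (fun a => (alpha a, theta a) : (B * E)%type).
  by move=> r x y; congr pair; rewrite /= linearP.
have hG0 := submodule_image (mk_linear g0_linear) (@submoduleT _ A).
have [|G [hG G0G GZ Gmax]] := @zorn_avoid _ _ _ Z hG0.
  apply/seteqP; split=> // _ [[a _ <-] [/= /ker_sub]].
  by move=> ->.
have Gfun b e e' : G (b, e) -> G (b, e') -> e = e'.
  move=> Ge Ge'; apply: contrapT => ne.
  have : (G `&` Z) ((b, e) - (b, e')).
    split; first exact: submoduleB.
    by split; rewrite /= ?subrr // => /subr0_eq.
  by rewrite GZ.
have Gtot b : exists e, G (b, e).
  pose K0 : set (E * R^o)%type := [set z | G ((z.2 : R) *: b, - z.1)].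
  have hK0 : submodule K0.
    apply/submoduleP; split; first by rewrite /K0 /= scale0r oppr0; exact: (submodule0 hG).
    move=> r [e s] [e' s'] /= Ge Ge'.
    rewrite /K0 /= (_ : (_, _) = r *: (s *: b, - e) + (s' *: b, - e')).
      exact: submoduleL.
    by congr pair; rewrite /= ?scalerDl ?scalerA // opprD scalerN.
  have [|K [hK K0K KZ Kmax]] := @zorn_avoid _ _ _ [set z | z.1 <> 0 /\ z.2 = 0] hK0.
    apply/seteqP; split=> // -[e r] [/= Ge [ne0 r0]]; apply: ne0.
    rewrite /K0 /= r0 scale0r in Ge.
    by apply: oppr_inj; rewrite oppr0; apply: Gfun Ge _; exact: (submodule0 hG).
  have [Q [j [chi' [ess' j_inj j_surj]]]] := essential_quotient hK ess KZ Kmax.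
  have [e0 Ke0] : exists e0 : E, K (- e0, 1).
    (* If E were proper in Q, the image of its chain with Q put on top would have length k + 1,
       against the choice of E. *)
    apply: j_surj; apply: contrapT => nsurj.
    suff : (k.+1 <= k)%N by rewrite ltnn.
    apply: kmax; exists Q, chi'; split=> //.
    exists (fun i => if (i <= k)%N then j @` U i else setT); split=> i ik.
      by case: ifP => [/hU|_]; [exact: submodule_image|exact: submoduleT].
    rewrite ltnS in ik; rewrite ik; case: ltnP => [ik'|ki].
      have [sub nsub] := Ult i ik'; split; first exact: image_subset.
      move=> jsub; apply: nsub => e Ue.
      have /jsub[e' Ue' eq_e] : (j @` U i.+1) (j e) by exists e.
      by rewrite -[e](subrK e') (j_inj (e - e')) ?add0r // raddfB /= eq_e subrr.
    split=> // sub; apply: nsurj => q.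
    by have /sub[e _ <-] : [set: Q] q by []; exists e.
  (* If (b, e0) is not in G, some (b', e') in G has b' + r b = 0 and e' + r e0 <> 0. Adding (- e', -
     r), which lies in K0, to r (- e0, 1) gives a forbidden element of K. *)
  exists e0; apply: contrapT => /Gmax[[b' e'] [r [Gbe /= [e1 ne2]]]].
  have : (K `&` [set z | z.1 <> 0 /\ z.2 = 0]) (- (e' + r *: e0), 0).
    split; last by split=> //= /eqP; rewrite oppr_eq0 => /eqP.
    have -> : (- (e' + r *: e0), 0 : R^o) = (- e', - r : R^o) + r *: (- e0, 1 : R^o).
      congr pair => /=; first by rewrite scalerN opprD.
      by rewrite -[X in _ + X]/(r * 1 : R) mulr1 addNr.
    apply: submoduleD => //; last exact: submoduleZ.
    apply: K0K; rewrite /K0 /= opprK scaleNr.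
    by rewrite (_ : - _ = b') //; apply/esym/eqP; rewrite -addr_eq0; apply/eqP.
  by rewrite KZ.
have /choice[omega Gomega] := Gtot.
have omega_linear : linear omega.
  move=> r x y; apply: Gfun (Gomega _) _.
  rewrite (_ : (_, _) = r *: (x, omega x) + (y, omega y)) //.
  by apply: submoduleL => //; exact: Gomega.
exists (mk_linear omega_linear) => a; apply: Gfun (Gomega _) _.
by apply: G0G; exists a.
Qed.

End InjectiveHull.

(** * Presentations over an Artin algebra *)

Section OrdinalFamilies.
Variables (S : pzRingType) (V W : lmodType S) (k n : nat).

Let zero_linear (V1 V2 : lmodType S) : linear (fun _ : V1 => 0 : V2).
Proof. by move=> a x y; rewrite scaler0 addr0. Qed.

Lemma ranked_sep_ord (f : 'I_k -> {linear V -> W}) :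
  ranked (@submodule S W) n -> (forall v, (forall j, f j v = 0) -> v = 0) ->
  ranked (@submodule S V) (k * n).
Proof.
move=> rW f_inj; pose f' j := if insub j is Some i then f i else mk_linear (@zero_linear V W).
apply: (@ranked_sep _ V (fun=> W) k n f') => // v f'0; apply: f_inj => j.
by rewrite -(f'0 j (ltn_ord j)) /f' valK.
Qed.

Lemma ranked_gen_ord (f : 'I_k -> {linear W -> V}) :
  ranked (@submodule S W) n -> (forall v, exists w, v = \sum_j f j (w j)) ->
  ranked (@submodule S V) (k * n).
Proof.
move=> rW f_surj; pose f' j := if insub j is Some i then f i else mk_linear (@zero_linear W V).
apply: (@ranked_gen _ V W k n f') => // v; have [w ->] := f_surj v.
exists (fun j => if insub j is Some i then w i else 0).
by apply: eq_bigr => j _; rewrite /f' valK.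
Qed.

End OrdinalFamilies.

Lemma ranked_ffun (S : pzRingType) (V : lmodType S) a n :
  ranked (@submodule S V) n -> ranked (@submodule S {ffun 'I_a -> V}) (a * n).
Proof.
move=> rV.
have ev_linear i : linear (fun v : {ffun 'I_a -> V} => v i) by move=> r u v; rewrite !ffunE.
apply: (ranked_sep_ord (f := fun i => mk_linear (ev_linear i)) rV) => v v0.
by apply/ffunP => i; rewrite ffunE; exact: v0.
Qed.

Section ArtinAlgebra.
Variables (R : comPzRingType) (S : pzRingType) (psi : {rmorphism R -> S}).
Hypothesis psi_central : forall r s, psi r * s = s * psi r.

Lemma ranked_restr (V : lmodType S) n :
  ranked (@submodule R (restr V psi)) n -> ranked (@submodule S V) n.
Proof.
apply: ranked_sub => U hU; apply/submoduleP; split; first exact: (submodule0 hU).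
by move=> r u v; exact: (submoduleL hU).
Qed.

Hypothesis artR : artinian_module R^o.
Hypothesis psi_fg : exists (n : nat) (b : 'I_n -> S), forall x : S,
  exists c : 'I_n -> R, x = \sum_(i < n) psi (c i) * b i.

Lemma ranked_algebra : exists n, ranked (@submodule R (restr S^o psi)) n.
Proof.
have [n rR] := artinian_ranked artR; have [k [b b_gen]] := psi_fg.
have f_linear j : linear (fun r : R^o => psi r * b j : restr S^o psi).
  by move=> r x y; rewrite rmorphD rmorphM mulrDl -mulrA.
exists (k * n)%N; apply: (ranked_gen_ord (f := fun j => mk_linear (f_linear j)) rR).
exact: b_gen.
Qed.

Lemma finite_length_ranked_base (V : lmodType S) :
  finite_length V -> exists n, ranked (@submodule R (restr V psi)) n.
Proof.
move=> /finite_length_ranked[m rV]; have [n rS] := ranked_algebra.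
have [a [x x_gen]] := ranked_fingen rV (@submoduleT _ V).
have f_linear j : linear (fun s : restr S^o psi => ((s : S) *: x j : V) : restr V psi).
  by move=> r s t; rewrite scalerDl -scalerA.
exists (a * n)%N; apply: (ranked_gen_ord (f := fun j => mk_linear (f_linear j)) rS).
by move=> v; have [c] := proj1 (x_gen v) I; exists c.
Qed.

(** The relations between finitely many generators form a submodule of S^a, which has finite length,
    so finitely many relations generate them all. *)
Lemma finite_length_presentation (X : lmodType S) : finite_length X ->
  exists (a b : nat) (x : 'I_a -> X) (k : 'I_b -> 'I_a -> S), [/\
    forall z, exists c : 'I_a -> S, z = \sum_i c i *: x i,
    forall j, \sum_i k j i *: x i = 0 &
    forall (V : lmodType S) (v : 'I_a -> V),
      (forall j, \sum_i k j i *: v i = 0) ->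
      exists phi : {linear X -> V}, forall i, phi (x i) = v i].
Proof.
move=> /finite_length_ranked[m rX]; have [n /ranked_restr rS] := ranked_algebra.
have [a [x x_gen]] := ranked_fingen rX (@submoduleT _ X).
pose K : set {ffun 'I_a -> S^o} := [set c | \sum_i (c i : S) *: x i = 0].
have hK : submodule K.
  apply/submoduleP; split.
    by rewrite /K /= big1 // => i _; rewrite ffunE scale0r.
  move=> r c d Kc Kd; rewrite /K /=.
  transitivity (r *: (\sum_i (c i : S) *: x i) + \sum_i (d i : S) *: x i).
    rewrite scaler_sumr -big_split /=.
    by apply: eq_bigr => i _; rewrite !ffunE scalerDl scalerA.
  by rewrite Kc Kd scaler0 addr0.
have [b [k k_gen]] := ranked_fingen (ranked_ffun a rS) hK.
exists a, b, x, (fun j => (k j : {ffun 'I_a -> S^o})); split.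
- by move=> z; apply/x_gen.
- move=> j; apply/k_gen; exists (fun j' => (j' == j)%:R).
  rewrite (bigD1 j) //= eqxx scale1r big1 ?addr0 // => j' /negPf ->.
  by rewrite scale0r.
move=> V v v_rel.
have wd (c d : 'I_a -> S) : \sum_i c i *: x i = \sum_i d i *: x i ->
    \sum_i c i *: v i = \sum_i d i *: v i.
  move=> e; apply/eqP; rewrite -subr_eq0 -sumrB; apply/eqP.
  have /k_gen[t def_cd] : K [ffun i => c i - d i : S^o].
    rewrite /K /= (eq_bigr (fun i => c i *: x i - d i *: x i)).
      by rewrite sumrB e subrr.
    by move=> i _; rewrite ffunE scalerBl.
  transitivity (\sum_i \sum_j t j *: ((k j i : S) *: v i)).
    apply: eq_bigr => i _; rewrite -scalerBl.
    move/ffunP/(_ i): def_cd; rewrite ffunE => ->.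
    rewrite sum_ffunE scaler_suml; apply: eq_bigr => j _.
    by rewrite ffunE scalerA.
  rewrite exchange_big big1 // => j _.
  by rewrite -scaler_sumr v_rel scaler0.
have /choice[c c_gen] : forall z, exists c : 'I_a -> S, z = \sum_i c i *: x i.
  by move=> z; apply/x_gen.
have phi_linear : linear (fun z => \sum_i c z i *: v i).
  move=> r y z; rewrite (@wd _ (fun i => r * c y i + c z i)).
    rewrite scaler_sumr -big_split; apply: eq_bigr => i _ /=.
    by rewrite scalerDl scalerA.
  rewrite -c_gen {1}(c_gen y) {1}(c_gen z) scaler_sumr -big_split.
  by apply: eq_bigr => i _ /=; rewrite scalerDl scalerA.
exists (mk_linear phi_linear) => i /=.
rewrite (@wd _ (fun i' => (i' == i)%:R)).
  rewrite (bigD1 i) //= eqxx scale1r big1 ?addr0 // => i' /negPf ->.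
  by rewrite scale0r.
rewrite -c_gen (bigD1 i) //= eqxx scale1r big1 ?addr0 // => i' /negPf ->.
by rewrite scale0r.
Qed.

End ArtinAlgebra.

(** * The universal determined morphism *)

Section Determined.
Variables (R : comPzRingType) (S : pzRingType) (psi : {rmorphism R -> S}).
Hypothesis psi_central : forall r s, psi r * s = s * psi r.
Hypothesis artR : artinian_module R^o.
Hypothesis psi_fg : exists (n : nat) (b : 'I_n -> S), forall x : S,
  exists c : 'I_n -> R, x = \sum_(i < n) psi (c i) * b i.

(* A linear map V -> N * Hom_R(S^b, E) into this submodule consists of a linear *)
(* h : V -> N and an R-linear omega : V^b -> E with chi \o h^a = omega \o k.    *)
Definition pullback_set (N : lmodType S) a b (E : lmodType R)
    (chi : {linear restr {ffun 'I_a -> N} psi -> E}) (k : 'I_b -> 'I_a -> S)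
  : set (N * dual_type psi b E)%type :=
  [set z | forall i s, chi [ffun i' => if i' == i then s *: z.1 else 0] =
    dual_app (mulr_row ([ffun j => k j i] : row_space psi b) s) z.2].

Section Pullback.
Variables (N : lmodType S) (a b : nat) (E : lmodType R).
Variables (chi : {linear restr {ffun 'I_a -> N} psi -> E}) (k : 'I_b -> 'I_a -> S).

Let unit_ffun (V : lmodType S) (i : 'I_a) (v : V) : restr {ffun 'I_a -> V} psi :=
  [ffun i' => if i' == i then v else 0].

Let unit_ffunD (V : lmodType S) i (u v : V) : unit_ffun i (u + v) = unit_ffun i u + unit_ffun i v.
Proof. by apply/ffunP => i'; rewrite !ffunE; case: eqP => // _; rewrite addr0. Qed.

Let unit_ffun_sum (V : lmodType S) (v : {ffun 'I_a -> V}) : v = \sum_i unit_ffun i (v i).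
Proof.
apply/ffunP => i; rewrite sum_ffunE (bigD1 i) //= !ffunE eqxx big1 ?addr0 // => i'.
by rewrite ffunE eq_sym => /negPf ->.
Qed.

Let mulr_rowM y (s t : S) :
  mulr_row (mulr_row y s) t = mulr_row y (s * t) :> row_space psi b.
Proof. by apply/ffunP => j; rewrite !ffunE mulrA. Qed.

Let mulr_row1 y : mulr_row y 1 = y :> row_space psi b.
Proof. by apply/ffunP => j; rewrite !ffunE mulr1. Qed.

(** Since chi is only R-linear, stability under S comes from imposing the equations for every s:
    acting by t replaces s by s t. *)
Lemma submodule_pullback : submodule (pullback_set chi k).
Proof.
apply/submoduleP; split=> [i s|t [n w] [n' w'] hz hz' i s] /=.
  rewrite scaler0 (_ : finfun _ = 0) ?raddf0 ?(raddf0 (dual_eval E psi_central _)) //.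
  by apply/ffunP => i'; rewrite !ffunE; case: eqP.
rewrite scalerDr scalerA -/(unit_ffun i _) unit_ffunD raddfD.
rewrite [X in X + _]hz [X in _ + X]hz'.
set y : row_space psi b := finfun _.
transitivity (dual_app (mulr_row (mulr_row y s) t) w + dual_app (mulr_row y s) w') => //.
by rewrite mulr_rowM.
Qed.

(** Injectivity of E extends chi \o h^a along k to omega on V^b; the second component of q sends v
    to y |-> omega (y_j v)_j. *)
Lemma pullback_factor (V : lmodType S) (h : {linear V -> N}) :
  (forall (A B : lmodType R) (alpha : {linear A -> B}) (theta : {linear A -> E}),
    (forall a, alpha a = 0 -> theta a = 0) ->
    exists omega : {linear B -> E}, forall a, omega (alpha a) = theta a) ->
  (forall v : 'I_a -> V, (forall j, \sum_i k j i *: v i = 0) ->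
     chi [ffun i => h (v i)] = 0) ->
  exists q : {linear V -> (N * dual_type psi b E)%type},
    forall v, pullback_set chi k (q v) /\ (q v).1 = h v.
Proof.
move=> injE h_rel.
have alpha_linear : linear (fun v : restr {ffun 'I_a -> V} psi =>
    [ffun j => \sum_i k j i *: v i] : restr {ffun 'I_b -> V} psi).
  move=> r u v; apply/ffunP => j; rewrite !ffunE scaler_sumr -big_split.
  apply: eq_bigr => i _; rewrite !ffunE scalerDr !scalerA.
  by congr (_ *: _ + _); rewrite psi_central.
have theta_linear : linear (fun v : restr {ffun 'I_a -> V} psi =>
    chi [ffun i => h (v i)]).
  move=> r u v; rewrite -linearP; congr (chi _); apply/ffunP => i.
  by rewrite !ffunE linearP.
have [|omega omegaP] := injE _ _ (mk_linear alpha_linear) (mk_linear theta_linear).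
  move=> v /ffunP v0; apply: (h_rel v) => j.
  by have := v0 j; rewrite !ffunE.
have w_linear v : linear (fun y : row_space psi b =>
    omega [ffun j => ((y : {ffun 'I_b -> S^o}) j : S) *: v]).
  move=> r y z; rewrite -linearP; congr (omega _); apply/ffunP => j.
  by rewrite !ffunE scalerDl -scalerA.
pose w v : dual_type psi b E := mk_linear (w_linear v).
have q_linear : linear (fun v => (h v, w v) : (N * dual_type psi b E)%type).
  move=> t u v; congr pair; first exact: linearP.
  apply: linear_ext => y; rewrite /= -[RHS]/(omega _ + omega _) -raddfD.
  congr (omega _); apply/ffunP => j; rewrite !ffunE scalerDr scalerA.
  by [].
exists (mk_linear q_linear) => v; split=> // i s /=.
rewrite -[RHS]/(omega _).
have := omegaP (unit_ffun i (s *: v)) => /= e.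
transitivity (chi [ffun i' => h (unit_ffun i (s *: v) i')]).
  congr (chi _); apply/ffunP => i'; rewrite !ffunE.
  by case: eqP => _; rewrite ?linearZZ ?raddf0.
rewrite -e; congr (omega _); apply/ffunP => j; rewrite !ffunE.
rewrite (bigD1 i) //= !ffunE eqxx scalerA big1 ?addr0 // => i' /negPf ne.
by rewrite ffunE ne scaler0.
Qed.

(** With w_i the second component of z_i, chi takes the value sum_i w_i(column i of k) = sum_j
    (sum_i k_ji w_i)(e_j), which is zero by the relations. *)
Lemma pullback_vanish (z : 'I_a -> (N * dual_type psi b E)%type) :
  (forall i, pullback_set chi k (z i)) ->
  (forall j, \sum_i k j i *: (z i).2 = 0) -> chi [ffun i => (z i).1] = 0.
Proof.
move=> hz z_rel.
pose col i : row_space psi b := [ffun j => k j i].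
pose e j : row_space psi b := [ffun j' => (j' == j)%:R].
have col_sum i : col i = \sum_j mulr_row (e j) (k j i).
  apply/ffunP => j; rewrite sum_ffunE ffunE (bigD1 j) //= !ffunE eqxx mul1r.
  rewrite big1 ?addr0 // => j' ne; rewrite !ffunE eq_sym (negPf ne) mul0r //.
rewrite [X in chi X]unit_ffun_sum raddf_sum.
transitivity (\sum_i \sum_j dual_app (e j) (k j i *: (z i).2)).
  apply: eq_bigr => i _; rewrite ffunE.
  transitivity (dual_app (col i) (z i).2).
    by rewrite -[(z i).1]scale1r -[col i]mulr_row1; exact: hz.
  by rewrite col_sum [LHS](raddf_sum ((z i).2 : {linear _ -> _})).
rewrite exchange_big big1 // => j _.
by rewrite -dual_app_sum z_rel.
Qed.

(** Over R, elements of C are separated by the projection to N and the evaluations at p generators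
    of S^b, hence the p + 1 maps. *)
Lemma pullback_ranked (C : lmodType S)
    (i : {linear C -> (N * dual_type psi b E)%type}) n m :
  injective i -> ranked (@submodule R (restr N psi)) n ->
  ranked (@submodule R E) m -> exists l, ranked (@submodule S C) l.
Proof.
move=> i_inj rN rE; have [l rS] := ranked_algebra artR psi_fg.
have rY : ranked (@submodule R (row_space psi b)) (b * l).
  have ev_linear j : linear (fun y : row_space psi b =>
      (y : {ffun 'I_b -> S^o}) j : restr S^o psi).
    by move=> r u v; rewrite !ffunE.
  apply: (ranked_sep_ord (f := fun j => mk_linear (ev_linear j)) rS) => v v0.
  by apply/ffunP => j; rewrite ffunE; exact: v0.
have [p [y y_gen]] := ranked_fingen rY (@submoduleT _ (row_space psi b)).
pose y' (j : nat) := if insub j is Some j' then y j' else 0.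
have f0_linear : linear (fun c : restr C psi => (i c).1 : restr N psi).
  by move=> r u v; exact: (congr1 fst (linearP i (psi r) u v)).
have f1_linear j : linear (fun c : restr C psi => dual_eval E psi_central (y' j) (i c).2).
  move=> r u v; rewrite -[RHS]linearP; congr (dual_eval _ _ _ _).
  exact: (congr1 snd (linearP i (psi r) u v)).
pose W (j : nat) : lmodType R := if j is 0%N then restr N psi else E.
pose f (j : nat) : {linear restr C psi -> W j} :=
  match j return {linear restr C psi -> W j} with
  | 0%N => mk_linear f0_linear
  | j'.+1 => mk_linear (f1_linear j')
  end.
exists (p.+1 * maxn n m)%N; apply: (@ranked_restr _ _ psi).
apply: (@ranked_sep _ _ W _ _ f) => [[|j] _|c c0].
- exact: ranked_leq (leq_maxl _ _) rN.
- exact: ranked_leq (leq_maxr _ _) rE.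
apply: i_inj; rewrite raddf0 [LHS]surjective_pairing; congr pair.
  exact: (c0 0%N).
apply: linear_ext => z; have [d ->] := proj1 (y_gen z) I.
rewrite raddf_sum big1 // => j _.
rewrite [LHS](linearZZ ((i c).2 : {linear row_space psi b -> E})).
have := c0 j.+1 (ltn_ord j); rewrite /= /y' valK => e.
by rewrite -[X in _ *: X]/(dual_app (y j) (i c).2) e scaler0.
Qed.

End Pullback.

(** Multiplication by psi(r) is an S-endomorphism of X, so stability under End(X) gives stability
    under R. *)
Lemma submodule_restrictions (X N : lmodType S) a (x : 'I_a -> X)
    (H : set {linear X -> N}) : End_submodule H ->
  submodule ([set v | exists h, H h /\ forall i, v i = h (x i)]
    : set (restr {ffun 'I_a -> N} psi)).
Proof.
move=> [H0 HD HM]; apply/submoduleP; split.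
  by exists \0; split=> // i; rewrite ffunE.
move=> r u v [h [Hh hu]] [h' [Hh' hv]].
have e_linear : linear (fun z : X => psi r *: z).
  by move=> s y z; rewrite scalerDr !scalerA psi_central.
have := HD _ _ (HM h (mk_linear e_linear) Hh) Hh'.
set h'' : {linear X -> N} := (X in H X) => Hh''; exists h''; split=> // i.
by rewrite !ffunE hu hv /= linearZZ.
Qed.

(** For phi : X -> C the images of the generators satisfy the relations k, so chi kills the values
    of g \o phi on them; these are then the values of a member of H, which equals g \o phi. *)
Lemma determined_cover (X N : lmodType S) (H : set {linear X -> N}) :
  finite_length X -> finite_length N -> End_submodule H ->
  exists (C : lmodType S) (g : {linear C -> N}), [/\ finite_length C,
    forall phi : {linear X -> C}, H (g \o phi) &
    forall (V : lmodType S) (h : {linear V -> N}),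
      (forall phi : {linear X -> V}, H (h \o phi)) ->
      exists q : {linear V -> C}, g \o q =1 h].
Proof.
move=> flX flN hH.
have [a [b [x [k [x_gen k_rel k_ext]]]]] := finite_length_presentation artR psi_fg flX.
have [n rN] := finite_length_ranked_base artR psi_fg flN.
have rNa : ranked (@submodule R (restr {ffun 'I_a -> N} psi)) (a * n).
  have ev_linear i : linear (fun v : restr {ffun 'I_a -> N} psi => v i : restr N psi).
    by move=> r u v; rewrite !ffunE.
  apply: (ranked_sep_ord (f := fun i => mk_linear (ev_linear i)) rN) => v v0.
  by apply/ffunP => i; rewrite ffunE; exact: v0.
have [m rR] := artinian_ranked artR.
have [E [chi [[l rE] chi_ker injE]]] :=
  injective_hull (submodule_restrictions x hH) rR rNa.
have [C [i [i_inj iC i_lift]]] := submodule_module (submodule_pullback chi k).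
have g_linear : linear (fun c => (i c).1) by move=> t u v; rewrite linearP.
exists C, (mk_linear g_linear); split.
- by have [l' rC] := pullback_ranked i_inj rN rE; exact: ranked_finite_length rC.
- move=> phi.
  have : chi [ffun i' => (i (phi (x i'))).1] = 0.
    apply: (@pullback_vanish N a b E chi k (fun i' => i (phi (x i')))) => // j.
    transitivity ((i (phi (\sum_i' k j i' *: x i'))).2); last by rewrite k_rel !raddf0.
    rewrite !raddf_sum; apply: eq_bigr => i' _.
    by rewrite /= !linearZZ.
  move=> /chi_ker[h [Hh hx]]; rewrite (_ : _ \o _ = h :> {linear X -> N}) //.
  apply: linear_ext => z; have [c ->] := x_gen z.
  rewrite !raddf_sum; apply: eq_bigr => i' _.
  by rewrite [RHS]linearZZ -hx ffunE /= !linearZZ.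
move=> V h h_H.
have [v v_rel|q qP] := pullback_factor (chi := chi) (k := k) (h := h) injE.
  have [phi phi_x] := k_ext V v v_rel.
  apply/chi_ker; exists (h \o phi); split; first exact: h_H.
  by move=> i'; rewrite ffunE /= phi_x.
have [q' q'P] := i_lift V q (fun v => proj1 (qP v)).
by exists q' => v; rewrite /= q'P; case: (qP v).
Qed.

End Determined.

(** * Right modules and the passage to an approximation *)

(** Commutativity of R makes [phi] multiplicative for the reversed product too. *)
Lemma converse_rmorphism (R : comPzRingType) (L : pzRingType)
    (phi : {rmorphism R -> L}) :
  exists psi : {rmorphism R -> L^c}, forall r, psi r = phi r.
Proof.
pose f : R -> L^c := phi.
have fD : nmod_morphism f by split=> [|x y]; [exact: (rmorph0 phi)|exact: (rmorphD phi)].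
have fM : monoid_morphism f.
  by split=> [|x y]; [exact: (rmorph1 phi)|rewrite mulrC; exact: (rmorphM phi y x)].
pose fA := GRing.isNmodMorphism.Build R L^c f fD.
pose fR := GRing.isMonoidMorphism.Build R L^c f fM.
pose psi : {rmorphism R -> L^c} := HB.pack f fA fR.
by exists psi.
Qed.

Close Scope classical_set_scope.

Theorem theorem4p4 (R : comPzRingType) (L : pzRingType)
    (phi : {rmorphism R -> L}) (hL : artin_algebra phi)
    (d : nat) (hd : (1 <= d)%N)
    (M : lmodType L^c -> Prop) (hM : cluster_tilting d M)
    (X N : lmodType L^c) (hX : M X) (hN : M N)
    (H : set {linear X -> N}) (hH : End_submodule H) :
  exists (A : lmodType L^c) (g : {linear A -> N}),
    [/\ M A, right_determined M X g & Im_Hom X g = H].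
Proof.
case: hL => artR phi_central [n [b b_gen]].
case: hM => [[M_fl _ _ _] [contraM _] _ _].
have [psi psiE] := converse_rmorphism phi.
have psi_central r (s : L^c) : psi r * s = s * psi r.
  by rewrite psiE; exact/esym/phi_central.
have psi_fg : exists (n : nat) (b : 'I_n -> L^c), forall x : L^c,
    exists c : 'I_n -> R, x = \sum_(i < n) psi (c i) * b i.
  exists n, b => x; have [c ->] := b_gen x; exists c.
  by apply: eq_bigr => i _; rewrite psiE phi_central.
have [C [g [flC g_H g_lift]]] :=
  determined_cover psi_central artR psi_fg (M_fl _ hX) (M_fl _ hN) hH.
have [A [MA [a a_lift]]] := contraM C flC.
have image_H (h : {linear X -> A}) : H (Hom_post (g \o a) h).
  rewrite (_ : Hom_post _ _ = g \o (a \o h)); first exact: g_H.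
  exact: linear_ext.
have lift V : M V -> forall h : {linear V -> N},
    (forall phi : {linear X -> V}, H (h \o phi)) ->
    exists q : {linear V -> A}, (g \o a) \o q =1 h.
  move=> MV h /g_lift[q gq]; have [q' aq'] := a_lift V MV q.
  by exists q' => v; rewrite -gq /= -aq'.
exists A, (g \o a); split=> //.
- move=> V MV h h_sub; apply: lift => // f.
  have /h_sub[f' _ <-] : Im_Hom X h (h \o f) by exists f.
  exact: image_H.
apply/seteqP; split=> [_ [h _ <-]|h Hh]; first exact: image_H.
have [_ _ HM] := hH.
(* X itself is a test object: h \o f stays in H for every endomorphism f of X. *)
have [q aq] := lift X hX h (fun f => HM h f Hh).
by exists q => //; exact: linear_ext.
Qed.
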